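(* Consider the linear parabolic problem $$\text{minimize } J[u(\cdot,\cdot,\cdot)]=\int_0^T\iint_D g(u(x,y,t),x,y,t)\,dx\,dy\,dt,$$ $$\frac{\partial u(x,y,t)}{\partial t}-\Delta u(x,y,t)=Au(x,y,t)+Bw(x,y,t),\quad w(x,y,t)\in U,$$ $$u(x,y,0)=\alpha(x,y),\ u(x,0,t)=\beta_0(x,t),\ u(x,S,t)=\beta_S(x,t),\ u(0,y,t)=\gamma_0(y,t),\ u(L,y,t)=\gamma_L(y,t),$$ where $A$ and $B$ are $n\times n$ and $n\times r$ matrices, $U\subset\mathbb{R}^r$ is a convex closed set, and $g(\cdot,x,y,t)$ is a convex continuously differentiable function of $u$. The solution $\tilde u(x,y,t)$ corresponding to the control function $\tilde w(x,y,t)\in U$, $(x,y,t)\in D\times[0,T]$, minimizes $J[u(\cdot,\cdot,\cdot)]$ if there exists a solution $u^*(x,y,t)$ of the adjoint equation $$-\frac{\partial u^*(x,y,t)}{\partial t}-\Delta u^*(x,y,t)=A^*u^*(x,y,t)-g'_u(\tilde u(x,y,t),x,y,t)$$ satisfying $$u^*(x,y,T)=u^*(x,0,t)=u^*(x,S,t)=u^*(0,y,t)=u^*(L,y,t)=0$$ and $$\langle B\tilde w(x,y,t),u^*(x,y,t)\rangle=\max_{w\in U}\langle Bw,u^*(x,y,t)\rangle.$$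
   Context: $L,S,T>0$, $D=[0,L]\times[0,S]$, $\Delta=\frac{\partial^2}{\partial x^2}+\frac{\partial^2}{\partial y^2}$; $u$ takes values in $\mathbb{R}^n$; $\alpha:D\to\mathbb{R}^n$, $\beta_0,\beta_S:[0,L]\times[0,T]\to\mathbb{R}^n$, $\gamma_0,\gamma_L:[0,S]\times[0,T]\to\mathbb{R}^n$ are given continuous functions. $A^*$ is the transpose of $A$ and $g'_u$ is the gradient of $g$ in $u$. Solutions are classical: with $P_T=D\times(0,T)$, $\Gamma_T=\{(x,y)\in\partial D,0<t<T\}$, $D_0=\{(x,y)\in D,t=0\}$, feasible solutions $u$ belong to $C^{2,1}(P_T)\cap C(P_T\cup\Gamma_T\cup\bar D_0)$, where $C^{2,1}(P_T)$ consists of continuous functions with continuous partial derivatives $u_x,u_y,u_t,u_{xx},u_{yy}$ in $P_T$, and satisfy the equation together with the initial and boundary conditions; $u^*$ is a classical solution in the same sense, with the final face $t=T$ in place of the initial face. ''Minimizes $J$'' means among all feasible solutions corresponding to controls $w$ with $w(x,y,t)\in U$.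
   Formalization: The solutions u, ũ and the adjoint solution u* are additionally required to be bounded on D×(0,T) (automatic if continuous on D×[0,T]); without this the claim fails. J is required to be well defined for ũ and for all competing solutions. *)

(* Defs.v *)
From HB Require Import structures.
From mathcomp Require Export all_boot all_order all_algebra.
From mathcomp Require Export all_classical all_reals all_analysis.
Export numFieldNormedType.Exports.
Import Order.TTheory GRing.Theory Num.Theory.

Set Implicit Arguments.
Unset Strict Implicit.
Unset Printing Implicit Defensive.

Local Open Scope classical_set_scope.
Local Open Scope ring_scope.

Definition dot (R : realType) (n : nat) (a b : 'cV[R]_n) : R :=
  \sum_(i < n) a i 0 * b i 0.

Definition is_maximum (R : realType) (E : set R) (m : R) : Prop :=
  E m /\ ubound E m.

Definition gradient (R : realType) (n : nat) (f : 'cV[R]_n -> R)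
    (a : 'cV[R]_n) : 'cV[R]_n :=
  \col_(i < n) 'D_(delta_mx i 0) f a.

Definition continuously_differentiable (R : realType) (n : nat)
    (f : 'cV[R]_n -> R) : Prop :=
  (forall a, differentiable f a) /\ continuous (gradient f).

(* Derivative at x of the restriction of f to I: the usual two-sided derivative
   when x is interior to I, the one-sided one when x is an endpoint of I. *)
Section derivative_relative_to_a_set.
Context {R : realType} {n : nat}.
Implicit Types (I : set R) (f : R -> 'cV[R]_n) (x : R).

Definition quotient_in f x (x' : R) : 'cV[R]_n :=
  (x' - x)^-1 *: (f x' - f x).

Definition derivable_in I f x : Prop :=
  cvg (quotient_in f x @ within I x^').

Definition derive_in I f x : 'cV[R]_n :=
  lim (quotient_in f x @ within I x^').

End derivative_relative_to_a_set.

(* A point of space-time is p = (x, y, t) = ((x, y), t). *)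
Section parabolic_problem.
Context {R : realType}.
Variables L S T : R.

Definition D : set (R * R) := `[0, L] `*` `[0, S].

(* D is closed, hence P_T contains the lateral faces x = 0, L and y = 0, S;
   there the x- and y-derivatives are one-sided. *)
Definition P_T : set (R * R * R) := D `*` `]0, T[.
Definition Gamma_T : set (R * R * R) := (closure D `\` D°) `*` `]0, T[.
Definition D_at (t : R) : set (R * R * R) := D `*` [set t].

Section classes.
Context {n : nat}.
Implicit Types u : R * R * R -> 'cV[R]_n.

Definition d_x u (p : R * R * R) : 'cV[R]_n :=
  derive_in `[0, L] (fun x => u (x, p.1.2, p.2)) p.1.1.
Definition d_y u (p : R * R * R) : 'cV[R]_n :=
  derive_in `[0, S] (fun y => u (p.1.1, y, p.2)) p.1.2.
Definition d_t u (p : R * R * R) : 'cV[R]_n :=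
  derive1 (fun t => u (p.1, t)) p.2.

Definition has_d_x u (p : R * R * R) : Prop :=
  derivable_in `[0, L] (fun x => u (x, p.1.2, p.2)) p.1.1.
Definition has_d_y u (p : R * R * R) : Prop :=
  derivable_in `[0, S] (fun y => u (p.1.1, y, p.2)) p.1.2.
Definition has_d_t u (p : R * R * R) : Prop :=
  derivable (fun t => u (p.1, t)) p.2 1.

Definition laplacian u (p : R * R * R) : 'cV[R]_n :=
  d_x (d_x u) p + d_y (d_y u) p.

Definition C21 u : Prop :=
  (forall p, P_T p ->
     [/\ has_d_x u p, has_d_y u p, has_d_t u p,
         has_d_x (d_x u) p & has_d_y (d_y u) p]) /\
  [/\ {within P_T, continuous u},
      {within P_T, continuous (d_x u)} /\ {within P_T, continuous (d_y u)},
      {within P_T, continuous (d_t u)},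
      {within P_T, continuous (d_x (d_x u))} &
      {within P_T, continuous (d_y (d_y u))}].

(* Class of classical solutions attached to the time face t = t0 (t0 = 0 for
   the state, t0 = T for the adjoint state).  Boundedness holds as soon as u is
   continuous on the whole closed cylinder; it is required here because nothing
   else controls u near the opposite time face, and without it u can blow up
   there fast enough for the boundary terms of Green's formula to survive and
   for the sufficient condition of optimality to fail. *)
Definition classical_class (t0 : R) u : Prop :=
  [/\ C21 u,
      {within P_T `|` Gamma_T `|` closure (D_at t0), continuous u} &
      [bounded u p | p in P_T]].

Definition face_value (t0 : R) (alpha : R * R -> 'cV[R]_n) u : Prop :=
  forall x y, D (x, y) -> u (x, y, t0) = alpha (x, y).

Definition lateral_values
    (beta_0 beta_S gamma_0 gamma_L : R * R -> 'cV[R]_n) u : Prop :=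
  forall t, 0 < t < T ->
    (forall x, 0 <= x <= L ->
       u (x, 0, t) = beta_0 (x, t) /\ u (x, S, t) = beta_S (x, t)) /\
    (forall y, 0 <= y <= S ->
       u (0, y, t) = gamma_0 (y, t) /\ u (L, y, t) = gamma_L (y, t)).

End classes.

Section control_problem.
Context {n r : nat}.
Variables (A : 'M[R]_n) (B : 'M[R]_(n, r)) (U : set 'cV[R]_r).
Variable g : 'cV[R]_n -> R * R * R -> R.
Variable alpha : R * R -> 'cV[R]_n.
Variables beta_0 beta_S gamma_0 gamma_L : R * R -> 'cV[R]_n.

Definition solution (w : R * R * R -> 'cV[R]_r) (u : R * R * R -> 'cV[R]_n)
    : Prop :=
  [/\ classical_class 0 u,
      forall p, P_T p -> d_t u p - laplacian u p = A *m u p + B *m w p,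
      face_value 0 alpha u &
      lateral_values beta_0 beta_S gamma_0 gamma_L u].

Definition admissible_control (w : R * R * R -> 'cV[R]_r) : Prop :=
  forall p, (D `*` `[0, T]) p -> U (w p).

Definition adjoint_solution (u us : R * R * R -> 'cV[R]_n) : Prop :=
  [/\ classical_class T us,
      forall p, P_T p -> - d_t us p - laplacian us p =
        A^T *m us p - gradient (fun v => g v p) (u p),
      face_value T (fun=> 0) us &
      lateral_values (fun=> 0) (fun=> 0) (fun=> 0) (fun=> 0) us].

Definition maximum_condition (w : R * R * R -> 'cV[R]_r)
    (us : R * R * R -> 'cV[R]_n) : Prop :=
  forall p, P_T p ->
    is_maximum [set dot (B *m v) (us p) | v in U] (dot (B *m w p) (us p)).

Local Notation mu := (@lebesgue_measure R).

(* The faces t = 0 and t = T are negligible and left out, the class of u saying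
   nothing about u on one of them. *)
Definition J (u : R * R * R -> 'cV[R]_n) : \bar R :=
  (\int[(mu \x mu) \x mu]_(p in P_T) (g (u p) p)%:E)%E.

(* J u is meaningful, possibly infinite: the integrand is measurable and its
   positive and negative parts do not both have infinite integral. *)
Definition J_defined (u : R * R * R -> 'cV[R]_n) : Prop :=
  let f : measurableTypeR R * measurableTypeR R * measurableTypeR R -> R :=
    fun p => g (u p) p in
  measurable_fun P_T f /\
  ((\int[(mu \x mu) \x mu]_(p in P_T) ((f^\+)%R p)%:E < +oo)%E \/
   (\int[(mu \x mu) \x mu]_(p in P_T) ((f^\-)%R p)%:E < +oo)%E).

Definition feasible (u : R * R * R -> 'cV[R]_n) : Prop :=
  (exists w, admissible_control w /\ solution w u) /\ J_defined u.

Definition minimizes_J (u : R * R * R -> 'cV[R]_n) : Prop :=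
  feasible u /\ forall v, feasible v -> (J u <= J v)%E.

End control_problem.
End parabolic_problem.

(* Main.v *)
From HB Require Import structures.
Require Import Defs.
From mathcomp Require Import measurable_realfun ring lra.
Import Order.TTheory GRing.Theory Num.Theory.

(** Write z = u - ut for a competitor u with control w, and let <.,.> be the
scalar product. Convexity of g and the adjoint equation give, at every point
of the cylinder,

  g(u) - g(ut) >= <g'(ut), z> = <us_t + Lap us + A^* us, z>.

Since z_t - Lap z = A z + B (w - wt), the right-hand side equals

  d/dt <us, z> + (<Lap us, z> - <us, Lap z>) - <us, B (w - wt)>,

and the last term is nonnegative by the maximum condition. Hence
g(u) - g(ut) >= F, where F, the sum of [green_density] over the coordinates,
is d/dt <us, z> plus the Green integrand; this is [cost_gap].

Nothing bounds F near t = 0 and t = T, so F is integrated over the boxes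
D x [e, T - e] only. There the spatial part integrates to 0: us and z
vanish on the lateral boundary, and along each segment parallel to an axis the
integrand is the derivative of p' q - p q'. The time part leaves the
difference of the integrals of <us, z> over D at t = T - e and t = e
([green_formula]). Both tend to 0 by dominated convergence, because us and z are
bounded, us vanishes at t = T and z vanishes at t = 0 ([green_limit]).

Finally, J ut <= J u is deduced although neither integral has to be finite and
F need not be integrable on the whole cylinder: the inequality is rearranged
between nonnegative functions, the positive and negative parts of the two
costs, whose integrals over the boxes increase to those over the cylinder
([integral_le_of_vanishing_defect]). *)

Set Implicit Arguments.
Unset Strict Implicit.
Unset Printing Implicit Defensive.

Local Open Scope classical_set_scope.
Local Open Scope ring_scope.

(** * Continuous functions on space-time are measurable *)

(** The family O plays the part of a topology; it is kept apart from the type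
because the measurable structure on a product of lines and its topology live on
differently tagged copies of the same set. *)
Definition countably_based {d} {T : measurableType d} (O : set (set T)) :=
  exists (I : countType) (B : I -> set T), (forall i, measurable (B i)) /\
    forall A x, O A -> A x -> exists2 i, B i x & B i `<=` A.

Lemma countably_based_measurable d (T : measurableType d) (O : set (set T)) :
  countably_based O -> O `<=` measurable.
Proof.
move=> [I [B [mB BO]]] A OA.
have -> : A = \bigcup_(i in [set i | B i `<=` A]) B i.
  apply/seteqP; split=> [x Ax|x [i BA Bix]]; last exact: BA.
  by have [i Bix BA] := BO _ _ OA Ax; exists i.
rewrite bigcup_mkcond; apply: countable_bigcupT_measurable => // i.
by case: ifP.
Qed.

(** Rectangles of basic sets form a basis of the product, and they are measurable
for the product sigma-algebra; so the Borel sets of a product of second-countable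
spaces are measurable for that sigma-algebra. *)
Lemma countably_based_prod d1 d2 (T1 : measurableType d1)
    (T2 : measurableType d2) (O1 : set (set T1)) (O2 : set (set T2))
    (O : set (set (T1 * T2))) :
  countably_based O1 -> countably_based O2 ->
  (forall A x, O A -> A x -> exists A1 A2,
     [/\ O1 A1, O2 A2, A1 x.1, A2 x.2 & A1 `*` A2 `<=` A]) ->
  countably_based O.
Proof.
move=> [I1 [B1 [mB1 BO1]]] [I2 [B2 [mB2 BO2]]] OP.
exists (I1 * I2)%type, (fun i => B1 i.1 `*` B2 i.2); split.
  by move=> i; exact: measurableX.
move=> A x OA Ax; have [A1 [A2 [OA1 OA2 A1x A2x sA]]] := OP _ _ OA Ax.
have [i1 ? s1] := BO1 _ _ OA1 A1x; have [i2 ? s2] := BO2 _ _ OA2 A2x.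
exists (i1, i2) => // y [/s1 ? /s2 ?]; exact: sA.
Qed.

Lemma open_prod_box (T1 T2 : topologicalType) (A : set (T1 * T2)) x :
  open A -> A x -> exists A1 A2,
    [/\ open A1, open A2, A1 x.1, A2 x.2 & A1 `*` A2 `<=` A].
Proof.
move=> oA Ax; have [[B1 B2] [/= nB1 nB2] sB] : nbhs x A.
  exact: open_nbhs_nbhs.
exists B1°, B2°; split; [exact: open_interior|exact: open_interior|exact: nB1|
  exact: nB2|].
move=> y [] /interior_subset ? /interior_subset ?; exact: sB.
Qed.

Lemma countably_based_real (R : realType) :
  countably_based (@open R : set (set (measurableTypeR R))).
Proof.
exists (rat * rat)%type, (fun q => `]ratr q.1, ratr q.2[%classic); split.
  by move=> q; exact: measurable_itv.
move=> A x oA Ax; have /nbhs_ballP[e /= e0 xeA] : nbhs x A.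
  exact: open_nbhs_nbhs.
have [p] := @rat_in_itvoo R (x - e) x ltac:(by rewrite gtrBl).
have [q] := @rat_in_itvoo R x (x + e) ltac:(by rewrite ltrDl).
rewrite !in_itv/= => /andP[xq qe] /andP[ep px].
exists (p, q); first by rewrite /= in_itv/= px.
move=> y /=; rewrite in_itv/= => /andP[py yq]; apply: xeA.
rewrite /ball/= ltr_distlC; apply/andP; split.
  exact: lt_trans py.
exact: lt_trans qe.
Qed.

Lemma countably_based_space_time (R : realType) :
  countably_based (@open (R * R * R)%type
    : set (set (measurableTypeR R * measurableTypeR R * measurableTypeR R))).
Proof.
apply: (@countably_based_prod _ _ _ _ (@open (R * R)%type)).
- apply: (@countably_based_prod _ _ _ _ (@open R) (@open R)).
  + exact: countably_based_real.
  + exact: countably_based_real.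
  + by move=> A x oA Ax; exact: open_prod_box.
- exact: countably_based_real.
- by move=> A x oA Ax; exact: open_prod_box.
Qed.

Lemma within_continuous_measurable_fun (R : realType)
    (A : set (measurableTypeR R * measurableTypeR R * measurableTypeR R))
    (f : R * R * R -> R) :
  measurable A -> {within (A : set (R * R * R)), continuous f} ->
  measurable_fun A f.
Proof.
move=> mA /continuousP cf; apply: (measurability _ (RGenOpens.measurableE R)).
move=> _ [_ [a [b ->] <-]].
have /cf/open_subspaceP[V oV VA] : open `]a, b[%classic by exact: interval_open.
rewrite setIC -VA; apply: measurableI => //.
exact: countably_based_measurable (countably_based_space_time R) _ oV.
Qed.

(** * Iterated integrals over rectangles and boxes *)

Section integral_over_rectangle.
Local Open Scope ereal_scope.
Context d1 d2 (T1 : measurableType d1) (T2 : measurableType d2) (R : realType).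
Variables (m1 : {sigma_finite_measure set T1 -> \bar R})
          (m2 : {sigma_finite_measure set T2 -> \bar R}).
Variables (A1 : set T1) (A2 : set T2) (f : T1 * T2 -> \bar R).
Hypotheses (mA1 : measurable A1) (mA2 : measurable A2).
Hypothesis intf : (m1 \x m2).-integrable (A1 `*` A2) f.

Let restrict_rectangle x y :
  (f \_ (A1 `*` A2)) (x, y) =
  (if x \in A1 then if y \in A2 then f (x, y) else 0 else 0).
Proof. by rewrite patchE in_setX/=; case: (x \in A1); case: (y \in A2). Qed.

Lemma integral_setX_12 : \int[m1 \x m2]_(z in A1 `*` A2) f z =
  \int[m1]_(x in A1) \int[m2]_(y in A2) f (x, y).
Proof.
rewrite integral_mkcond -integral12_prod_meas1; last first.
  exact: (integrable_mkcond f (measurableX mA1 mA2)).1.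
rewrite [RHS]integral_mkcond; apply: eq_integral => x _.
rewrite /fubini_F patchE; under eq_integral do rewrite restrict_rectangle.
case: ifP => _; last by rewrite integral0.
by rewrite [RHS]integral_mkcond; apply: eq_integral => y _; rewrite patchE.
Qed.

Lemma integral_setX_21 : \int[m1 \x m2]_(z in A1 `*` A2) f z =
  \int[m2]_(y in A2) \int[m1]_(x in A1) f (x, y).
Proof.
rewrite integral_mkcond -integral21_prod_meas1; last first.
  exact: (integrable_mkcond f (measurableX mA1 mA2)).1.
rewrite [RHS]integral_mkcond; apply: eq_integral => y _.
rewrite /fubini_G patchE; under eq_integral do rewrite restrict_rectangle.
case: ifP => _; last first.
  by under eq_integral do rewrite if_same; rewrite integral0.
by rewrite [RHS]integral_mkcond; apply: eq_integral => x _; rewrite patchE.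
Qed.

End integral_over_rectangle.

Section boxes.
Variable R : realType.
Local Notation mu := (@lebesgue_measure R).
Local Notation RR := (measurableTypeR R).

Lemma measurable_segment (a b : R) : measurable (`[a, b]%classic : set RR).
Proof. exact: measurable_itv. Qed.

Lemma lebesgue_itv_lty (a b : R) : (mu `[a, b]%classic < +oo)%E.
Proof.
by rewrite lebesgue_measure_itv/=; case: ifP => // _; rewrite -EFinB ltry.
Qed.

Lemma lebesgue_rectangle_lty (a b c d : R) :
  ((mu \x mu) ((`[a, b] `*` `[c, d])%R : set (RR * RR)) < +oo)%E.
Proof.
rewrite product_measure1E; [|exact: measurable_segment..].
by rewrite lte_mul_pinfty// ?ge0_fin_numE//; exact: lebesgue_itv_lty.
Qed.

(** Fubini for (mu \x mu) \x mu asks for a sigma-finite structure on the first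
factor; this alias of mu \x mu carries it. *)
Definition area : set (RR * RR) -> \bar R := (mu \x mu)%E.

HB.instance Definition _ := Measure.on area.

Lemma area_sigma_finite : sigma_finite setT area.
Proof.
exists (fun n : nat => `[- n%:R, n%:R] `*` `[- n%:R, n%:R]).
  apply/esym; rewrite -subTset => -[x y] _.
  (* one radius serves both coordinates *)
  exists (Num.truncn (`|x| + `|y|)).+1 => //=.
  have xyn := truncnS_gt (`|x| + `|y|).
  rewrite !in_itv/= -!ler_norml; split; apply: le_trans (ltW xyn).
    by rewrite lerDl.
  by rewrite lerDr.
move=> n; split; last exact: lebesgue_rectangle_lty.
by apply: measurableX; exact: measurable_segment.
Qed.

HB.instance Definition _ := Measure_isSigmaFinite.Build _ _ _ area
  area_sigma_finite.

Definition box (L S a b : R) : set (RR * RR * RR) := D L S `*` `[a, b].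

Lemma measurable_D (L S : R) : measurable (D L S : set (RR * RR)).
Proof. by apply: measurableX; exact: measurable_itv. Qed.

Lemma measurable_box L S a b : measurable (box L S a b).
Proof. by apply: measurableX; [exact: measurable_D|exact: measurable_itv]. Qed.

Lemma measure_D_lty L S : ((mu \x mu)%E (D L S : set (RR * RR)) < +oo)%E.
Proof. exact: lebesgue_rectangle_lty. Qed.

Lemma measure_box_lty L S a b :
  (((mu \x mu) \x mu)%E (box L S a b) < +oo)%E.
Proof.
rewrite product_measure1E; [|exact: measurable_D|exact: measurable_itv].
rewrite lte_mul_pinfty//.
  by rewrite ge0_fin_numE//; exact: measure_D_lty.
exact: lebesgue_itv_lty.
Qed.

Lemma compact_box L S a b : compact (box L S a b : set (R * R * R)).
Proof.
apply: compact_setX; last exact: segment_compact.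
by apply: compact_setX; exact: segment_compact.
Qed.

Lemma continuous_box_integrable L S a b (f : R * R * R -> R) :
  {within (box L S a b : set (R * R * R)), continuous f} ->
  ((mu \x mu) \x mu)%E.-integrable (box L S a b) (EFin \o f).
Proof.
move=> cf; apply: measurable_bounded_integrable.
- exact: measurable_box.
- exact: measure_box_lty.
- by apply: within_continuous_measurable_fun => //; exact: measurable_box.
- have /compact_bounded := continuous_compact cf (@compact_box L S a b).
  move=> [M [Mr Mf]]; exists M; split => // N MN z Qz.
  by apply: (Mf N MN); exists z.
Qed.
End boxes.

Section iterated.
Variable R : realType.
Local Notation mu := (@lebesgue_measure R).
Local Notation RR := (measurableTypeR R).
Variables (L S a b : R) (f : R * R * R -> R).
Hypothesis cf : {within (box L S a b : set (R * R * R)), continuous f}.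

Lemma measurable_fun_slice t : a <= t <= b ->
  measurable_fun (D L S : set (RR * RR)) (fun z : RR * RR => f (z, t)).
Proof.
move=> tab; apply: (@measurable_comp _ _ _ _ _ _ (box L S a b) f).
- exact: measurable_box.
- by move=> _ [z Dz <-]; split => //=; rewrite in_itv.
- exact: within_continuous_measurable_fun (measurable_box _ _ _ _) cf.
- by apply: measurable_funTS; exact: measurable_fun_pair.
Qed.

Lemma integrable_slice t : a <= t <= b ->
  (mu \x mu)%E.-integrable (D L S : set (RR * RR)) (fun z => (f (z, t))%:E).
Proof.
move=> tab; apply: measurable_bounded_integrable.
- exact: measurable_D.
- exact: measure_D_lty.
- exact: measurable_fun_slice.
- have /compact_bounded := continuous_compact cf (@compact_box R L S a b).
  move=> [M [Mr Mf]]; exists M; split => // N MN z Dz.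
  by apply: (Mf N MN); exists (z, t) => //; split => //=; rewrite in_itv.
Qed.

Lemma integral_box_x0 :
  (forall y t, 0 <= y <= S -> a <= t <= b ->
    (\int[mu]_(x in `[0%R, L]) (f (x, y, t))%:E = 0)%E) ->
  (\int[(mu \x mu) \x mu]_(p in box L S a b) (f p)%:E = 0)%E.
Proof.
move=> f0; apply: etrans (@integral_setX_21 _ _ _ _ _ (@area R) mu _ _ _
  (measurable_D L S) (measurable_segment a b) (continuous_box_integrable cf)) _.
apply: integral0_eq => t /=; rewrite in_itv/= => tab.
apply: etrans (@integral_setX_21 _ _ _ _ _ mu mu _ _ _ (measurable_segment 0 L)
  (measurable_segment 0 S) (integrable_slice tab)) _.
by apply: integral0_eq => y /=; rewrite in_itv/= => yS; exact: f0.
Qed.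

Lemma integral_box_y0 :
  (forall x t, 0 <= x <= L -> a <= t <= b ->
    (\int[mu]_(y in `[0%R, S]) (f (x, y, t))%:E = 0)%E) ->
  (\int[(mu \x mu) \x mu]_(p in box L S a b) (f p)%:E = 0)%E.
Proof.
move=> f0; apply: etrans (@integral_setX_21 _ _ _ _ _ (@area R) mu _ _ _
  (measurable_D L S) (measurable_segment a b) (continuous_box_integrable cf)) _.
apply: integral0_eq => t /=; rewrite in_itv/= => tab.
apply: etrans (@integral_setX_12 _ _ _ _ _ mu mu _ _ _ (measurable_segment 0 L)
  (measurable_segment 0 S) (integrable_slice tab)) _.
by apply: integral0_eq => x /=; rewrite in_itv/= => xL; exact: f0.
Qed.

Lemma integral_box_t (h : R * R * R -> R) :
  (forall z, D L S z ->
    (\int[mu]_(t in `[a, b]) (f (z, t))%:E = (h (z, b) - h (z, a))%:E)%E) ->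
  (\int[(mu \x mu) \x mu]_(p in box L S a b) (f p)%:E =
   \int[mu \x mu]_(z in D L S) (h (z, b) - h (z, a))%:E)%E.
Proof.
move=> fh; apply: etrans (@integral_setX_12 _ _ _ _ _ (@area R) mu _ _ _
  (measurable_D L S) (measurable_segment a b) (continuous_box_integrable cf)) _.
by apply: eq_integral => z; rewrite inE => /fh.
Qed.
End iterated.

(** * Green's identity in one variable *)

Section one_variable.
Variable R : realType.
Local Notation mu := (@lebesgue_measure R).

(** The derivative is only required inside [a, b]: this and continuity up to the
endpoints are what the fundamental theorem of calculus needs, so the one-sided
derivatives at the endpoints never have to be manipulated. *)
Definition C1_on (a b : R) (f f' : R -> R) :=
  [/\ {within `[a, b], continuous f}, {within `[a, b], continuous f'} &
      forall x, a < x < b -> is_derive x 1 f (f' x)].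

Lemma C1_onB a b f f' g g' : C1_on a b f f' -> C1_on a b g g' ->
  C1_on a b (f \- g) (f' \- g').
Proof.
move=> [cf cf' df] [cg cg' dg]; split.
- by move=> x; apply: cvgB; [exact: cf|exact: cg].
- by move=> x; apply: cvgB; [exact: cf'|exact: cg'].
- move=> x xab; have := df _ xab; have := dg _ xab => ? ?.
  exact: is_deriveB.
Qed.

Lemma C1_onM a b f f' g g' : C1_on a b f f' -> C1_on a b g g' ->
  C1_on a b (f \* g) (f' \* g \+ f \* g').
Proof.
move=> [cf cf' df] [cg cg' dg]; split.
- by move=> x; apply: cvgM; [exact: cf|exact: cg].
- move=> x; apply: cvgD; first by apply: cvgM; [exact: cf'|exact: cg].
  by apply: cvgM; [exact: cf|exact: cg'].
- move=> x xab; have := df _ xab; have := dg _ xab => ? ?.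
  apply: is_derive_eq (is_deriveM _ _) _.
  by rewrite /= addrC /GRing.scale/= (mulrC (g x)).
Qed.

Lemma C1_on_integral a b f f' : a < b -> C1_on a b f f' ->
  (\int[mu]_(x in `[a, b]) (f' x)%:E = (f b - f a)%:E)%E.
Proof.
move=> ab [cf cf' df]; have [_ fa fb] := (continuous_within_itvP f ab).1 cf.
apply: continuous_FTC2 => //.
- split=> // x; rewrite in_itv/= => /df dfx; exact: ex_derive.
- move=> x; rewrite in_itv/= => /df dfx; rewrite derive1E; exact: derive_val.
Qed.

(** The integrand is the derivative of p1 q - p q1, which vanishes at both ends
together with p and q. *)
Lemma green_identity a b p p1 p2 q q1 q2 : a < b ->
  C1_on a b p p1 -> C1_on a b p1 p2 -> C1_on a b q q1 -> C1_on a b q1 q2 ->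
  p a = 0 -> p b = 0 -> q a = 0 -> q b = 0 ->
  (\int[mu]_(x in `[a, b]) (p2 x * q x - p x * q2 x)%:E = 0)%E.
Proof.
move=> ab Cp Cp1 Cq Cq1 pa pb qa qb.
have := C1_on_integral ab (C1_onB (C1_onM Cp1 Cq) (C1_onM Cp Cq1)).
rewrite /= pa pb qa qb !mul0r !mulr0 !subr0 => I0.
rewrite -[RHS]I0; apply: eq_integral => x _; congr EFin => /=.
by rewrite opprD addrACA addrA subrK.
Qed.

End one_variable.

(** * Coordinates of vector-valued functions *)

Lemma within_continuous_precomp (X Y Z : topologicalType) (A : set X)
    (B : set Y) (h : X -> Y) (f : Y -> Z) :
  continuous h -> (forall x, A x -> B (h x)) ->
  {within B, continuous f} -> {within A, continuous (f \o h)}.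
Proof.
move=> ch hAB /subspace_continuousP cf.
apply: (subspace_continuousP A (f \o h)).2 => x Ax P /(cf _ (hAB _ Ax)) /= Pf.
have chP := ch x _ Pf; apply: (@filterS _ (nbhs x) _ _ _ _ chP) => x' /= + Ax'.
by apply; exact: hAB.
Qed.

Lemma within_continuous_coord (R : realType) (X : topologicalType) (A : set X)
    n (u : X -> 'cV[R]_n) i :
  {within A, continuous u} -> {within A, continuous (fun x => u x i 0)}.
Proof.
apply: (@within_continuous_comp _ _ _ A u (fun M : 'cV[R]_n => M i 0)) => M _.
exact: coord_continuous.
Qed.

Lemma is_derive_coord (R : realType) n (f : R -> 'cV[R]_n) (x : R)
    (l : 'cV[R]_n) i :
  h^-1 *: ((f \o shift x) (h *: 1) - f x) @[h --> 0^'] --> l ->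
  is_derive x 1 (fun y => f y i 0) (l i 0).
Proof.
move=> fl.
have fli : h^-1 *: (((fun y => f y i 0) \o shift x) (h *: 1) - f x i 0)
    @[h --> 0^'] --> l i 0.
  have := cvg_comp _ _ fl (@coord_continuous _ _ _ i 0 l).
  apply: cvg_trans; apply: near_eq_cvg; near=> h.
  by rewrite /= !mxE.
split; first by apply/cvg_ex; exists (l i 0).
exact: cvg_lim.
Unshelve. all: by end_near. Qed.

(** An interior point of [a, b] is approached only by points of [a, b], so the
derivative relative to the interval is there the ordinary one; the proof also
passes from quotients in x' tending to x to quotients in h tending to 0. *)
Lemma derivable_in_is_derive (R : realType) n (a b x : R) (f : R -> 'cV[R]_n)
    i :
  a < x < b -> derivable_in `[a, b] f x ->
  is_derive x 1 (fun y => f y i 0) (derive_in `[a, b] f x i 0).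
Proof.
move=> /andP[ax xb] dfx; apply: is_derive_coord.
have {}dfx : quotient_in f x @ within `[a, b] x^' --> derive_in `[a, b] f x.
  exact: dfx.
have nab : \forall y \near x, y \in `]a, b[.
  by apply: near_in_itvoo; rewrite in_itv/= ax.
move=> P /dfx Pf.
have {}Pf : \forall y \near x, y != x -> P (quotient_in f x y).
  apply: filterS2 nab Pf => y yab + yx; apply => //=.
  exact: subset_itv_oo_cc.
have {}Pf : \forall h \near 0^', x + h != x -> P (quotient_in f x (x + h)).
  by apply: nbhs_dnbhs; exact: (nbhs0P _ x).1 Pf.
suff H : \forall h \near (0 : R)^', P (h^-1 *: ((f \o shift x) h%:A - f x)).
  exact: H.
near=> h; rewrite /=.
have h0 : h != 0 by near: h; exact: nbhs_dnbhs_neq.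
have Ph : x + h != x -> P (quotient_in f x (x + h)) by near: h.
have -> : h%:A + x = x + h by rewrite addrC [h%:A]mulr1.
have -> : h^-1 *: (f (x + h) - f x) = quotient_in f x (x + h).
  by rewrite /quotient_in (addrC x) addrK.
by apply: Ph; rewrite -subr_eq0 (addrC x) addrK.
Unshelve. all: by end_near. Qed.

Lemma is_derive_d_t (R : realType) n (u : R * R * R -> 'cV[R]_n) p i :
  has_d_t u p -> is_derive p.2 1 (fun t => u (p.1, t) i 0) (d_t u p i 0).
Proof.
move=> du; apply: (@is_derive_coord _ _ (fun t => u (p.1, t))).
rewrite /d_t derive1E; exact: du.
Qed.

(** * Green's formula on a box of space-time *)

Definition C2_on (R : realType) (a b : R) (f f'' : R -> R) :=
  exists f', C1_on a b f f' /\ C1_on a b f' f''.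

Lemma C2_onB (R : realType) (a b : R) f f'' g g'' :
  C2_on a b f f'' -> C2_on a b g g'' -> C2_on a b (f \- g) (f'' \- g'').
Proof.
move=> [f' [? ?]] [g' [? ?]]; exists (f' \- g').
by split; exact: C1_onB.
Qed.

Section green.
Variable R : realType.
Local Notation mu := (@lebesgue_measure R).
Local Notation RR := (measurableTypeR R).
Variables L S T : R.
Implicit Types p q v : R * R * R -> R.

(** What the argument uses of the class C^{2,1} for one coordinate of a solution:
global continuity of the functions that occur in the Green integrand, and
differentiability along segments parallel to the axes. The derivatives are
parameters, so that the coordinates of one-sided limits can be substituted for
them. *)
Record scalar_C21 v v_t v_xx v_yy : Prop := ScalarC21 {
  cont_v : {within P_T L S T, continuous v};
  cont_v_t : {within P_T L S T, continuous v_t};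
  cont_v_xx : {within P_T L S T, continuous v_xx};
  cont_v_yy : {within P_T L S T, continuous v_yy};
  v_C1t : forall z a b, D L S z -> 0 < a -> b < T ->
    C1_on a b (fun t => v (z, t)) (fun t => v_t (z, t));
  v_C2x : forall y t, 0 <= y <= S -> 0 < t < T ->
    C2_on 0 L (fun x => v (x, y, t)) (fun x => v_xx (x, y, t));
  v_C2y : forall x t, 0 <= x <= L -> 0 < t < T ->
    C2_on 0 S (fun y => v (x, y, t)) (fun y => v_yy (x, y, t)) }.

Lemma scalar_C21B v v_t v_xx v_yy q q_t q_xx q_yy :
  scalar_C21 v v_t v_xx v_yy -> scalar_C21 q q_t q_xx q_yy ->
  scalar_C21 (v \- q) (v_t \- q_t) (v_xx \- q_xx) (v_yy \- q_yy).
Proof.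
move=> [c ct cx cy dt dx dy] [c' ct' cx' cy' dt' dx' dy']; split.
- by move=> x; apply: cvgB; [exact: c|exact: c'].
- by move=> x; apply: cvgB; [exact: ct|exact: ct'].
- by move=> x; apply: cvgB; [exact: cx|exact: cx'].
- by move=> x; apply: cvgB; [exact: cy|exact: cy'].
- by move=> z a b Dz a0 bT; apply: C1_onB; [exact: dt|exact: dt'].
- by move=> y t yS tT; apply: C2_onB; [exact: dx|exact: dx'].
- by move=> y t yS tT; apply: C2_onB; [exact: dy|exact: dy'].
Qed.

Definition lateral_zero v := forall t, 0 < t < T ->
  (forall x, 0 <= x <= L -> v (x, 0, t) = 0 /\ v (x, S, t) = 0) /\
  (forall y, 0 <= y <= S -> v (0, y, t) = 0 /\ v (L, y, t) = 0).

Lemma box_sub_P_T a b : 0 < a -> b < T ->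
  (box L S a b : set (R * R * R)) `<=` P_T L S T.
Proof.
move=> a0 bT p [Dp /=]; rewrite in_itv/= => /andP[ap pb]; split => //=.
by rewrite in_itv/= (lt_le_trans a0)// (le_lt_trans pb).
Qed.

Hypotheses (L0 : 0 < L) (S0 : 0 < S).

Section pair.
Variables p p_t p_xx p_yy q q_t q_xx q_yy : R * R * R -> R.
Hypotheses (Cp : scalar_C21 p p_t p_xx p_yy) (Cq : scalar_C21 q q_t q_xx q_yy).
Hypotheses (p0 : lateral_zero p) (q0 : lateral_zero q).

(** This is d/dt (p q) + (Lap p) q - p (Lap q), with the derivatives of p and q
given as functions. *)
Definition green_density w :=
  (p_t w * q w + p w * q_t w) +
  ((p_xx w * q w - p w * q_xx w) + (p_yy w * q w - p w * q_yy w)).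

Section one_box.
Variables a b : R.
Hypotheses (a0 : 0 < a) (ab : a < b) (bT : b < T).
Local Notation Q := (box L S a b).

Let within_box v : {within P_T L S T, continuous v} ->
  {within (Q : set (R * R * R)), continuous v}.
Proof. by apply: continuous_subspaceW; exact: box_sub_P_T. Qed.

Let cM v1 v2 v3 v4 :
  {within P_T L S T, continuous v1} -> {within P_T L S T, continuous v2} ->
  {within P_T L S T, continuous v3} -> {within P_T L S T, continuous v4} ->
  {within (Q : set (R * R * R)), continuous (v1 \* v2 \- v3 \* v4)}.
Proof.
move=> c1 c2 c3 c4 w; apply: cvgB; apply: cvgM; exact: within_box.
Qed.

Let inT t : a <= t <= b -> 0 < t < T.
Proof. by move=> /andP[ta tb]; rewrite (lt_le_trans a0)// (le_lt_trans tb). Qed.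

Let cX : {within (Q : set (R * R * R)), continuous (p_xx \* q \- p \* q_xx)}.
Proof. exact: cM (cont_v_xx Cp) (cont_v Cq) (cont_v Cp) (cont_v_xx Cq). Qed.

Let cY : {within (Q : set (R * R * R)), continuous (p_yy \* q \- p \* q_yy)}.
Proof. exact: cM (cont_v_yy Cp) (cont_v Cq) (cont_v Cp) (cont_v_yy Cq). Qed.

Let cT : {within (Q : set (R * R * R)), continuous (p_t \* q \+ p \* q_t)}.
Proof.
move=> w; apply: cvgD; apply: cvgM.
- exact: within_box (cont_v_t Cp) w.
- exact: within_box (cont_v Cq) w.
- exact: within_box (cont_v Cp) w.
- exact: within_box (cont_v_t Cq) w.
Qed.

Let cpq : {within (Q : set (R * R * R)), continuous (p \* q)}.
Proof.
move=> w; apply: cvgM.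
- exact: within_box (cont_v Cp) w.
- exact: within_box (cont_v Cq) w.
Qed.

Let IX :
  (\int[(mu \x mu) \x mu]_(w in Q) ((p_xx \* q \- p \* q_xx) w)%:E = 0)%E.
Proof.
apply: integral_box_x0 => // y t yS /inT tT.
have [p1 [? ?]] := v_C2x Cp yS tT; have [q1 [? ?]] := v_C2x Cq yS tT.
have [_ /(_ y yS)[? ?]] := p0 tT; have [_ /(_ y yS)[? ?]] := q0 tT.
exact: (@green_identity _ _ _ (fun x => p (x, y, t)) p1
  (fun x => p_xx (x, y, t)) (fun x => q (x, y, t)) q1).
Qed.

Let IY :
  (\int[(mu \x mu) \x mu]_(w in Q) ((p_yy \* q \- p \* q_yy) w)%:E = 0)%E.
Proof.
apply: integral_box_y0 => // x t xL /inT tT.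
have [p1 [? ?]] := v_C2y Cp xL tT; have [q1 [? ?]] := v_C2y Cq xL tT.
have [/(_ x xL)[? ?] _] := p0 tT; have [/(_ x xL)[? ?] _] := q0 tT.
exact: (@green_identity _ _ _ (fun y => p (x, y, t)) p1
  (fun y => p_yy (x, y, t)) (fun y => q (x, y, t)) q1).
Qed.

Let IT : (\int[(mu \x mu) \x mu]_(w in Q) ((p_t \* q \+ p \* q_t) w)%:E =
  \int[mu \x mu]_(z in D L S)
    (p (z, b) * q (z, b) - p (z, a) * q (z, a))%:E)%E.
Proof.
apply: (integral_box_t cT (h := p \* q)) => z Dz.
exact: C1_on_integral ab (C1_onM (v_C1t Cp Dz a0 bT) (v_C1t Cq Dz a0 bT)).
Qed.

Lemma green_density_integrable :
  ((mu \x mu) \x mu)%E.-integrable Q (EFin \o green_density).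
Proof.
apply: continuous_box_integrable => w.
by apply: cvgD; [exact: cT|apply: cvgD; [exact: cX|exact: cY]].
Qed.

(** The two spatial terms integrate to zero along every segment parallel to their
axis, by the lateral boundary conditions; the time term is integrated
exactly. *)
Lemma green_formula :
  (\int[(mu \x mu) \x mu]_(w in Q) (green_density w)%:E =
  \int[mu \x mu]_(z in D L S)
    (p (z, b) * q (z, b) - p (z, a) * q (z, a))%:E)%E.
Proof.
have iX := continuous_box_integrable cX.
have iY := continuous_box_integrable cY.
have iT := continuous_box_integrable cT.
have mQ := measurable_box L S a b.
rewrite (integralD mQ iT (integrableD mQ iX iY)) (integralD mQ iX iY).
by rewrite IX IY IT !adde0.
Qed.

Lemma measurable_green_boundary : measurable_fun (D L S : set (RR * RR))
  (fun z : RR * RR => p (z, b) * q (z, b) - p (z, a) * q (z, a)).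
Proof.
by apply: measurable_funB; apply: (measurable_fun_slice cpq); rewrite lexx ltW.
Qed.

End one_box.
End pair.
End green.

(** * Letting the box fill the cylinder *)

Section margins.
Variables (R : realType) (T : R).
Hypothesis T0 : 0 < T.

(** The factor 1/3 keeps the interval [margin k, T - margin k] nondegenerate from
k = 0 on. *)
Definition margin (k : nat) : R := T / 3 * harmonic k.

Lemma margin_gt0 k : 0 < margin k.
Proof. by rewrite mulr_gt0 ?divr_gt0// harmonic_gt0. Qed.

Lemma margin_lt k : margin k < T - margin k.
Proof.
have : margin k <= T / 3.
  by rewrite ler_piMr ?divr_ge0 ?(ltW T0)//= invf_le1 ?ltr0n// ler1n.
move: (margin_gt0 k); move: T0; lra.
Qed.

Lemma margin_nincr : {homo margin : i j / (i <= j)%N >-> j <= i}.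
Proof.
move=> i j ij; rewrite ler_pM2l ?divr_gt0//= lef_pV2 ?posrE ?ltr0n//.
by rewrite ler_nat.
Qed.

Lemma cvg_margin : margin @ \oo --> 0.
Proof.
rewrite -[X in _ --> X](mulr0 (T / 3)).
by apply: cvgM; [exact: cvg_cst|exact: cvg_harmonic].
Qed.

End margins.

Section green_limit.
Variable R : realType.
Local Notation mu := (@lebesgue_measure R).
Local Notation RR := (measurableTypeR R).
Variables L S T : R.
Hypotheses (L0 : 0 < L) (S0 : 0 < S) (T0 : 0 < T).
Variables p p_t p_xx p_yy q q_t q_xx q_yy : R * R * R -> R.
Hypotheses (Cp : scalar_C21 L S T p p_t p_xx p_yy)
           (Cq : scalar_C21 L S T q q_t q_xx q_yy).
Hypotheses (p0 : lateral_zero L S T p) (q0 : lateral_zero L S T q).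
Variables M N : R.
Hypotheses (pM : forall w, P_T L S T w -> `|p w| <= M)
           (qN : forall w, P_T L S T w -> `|q w| <= N).
Hypotheses (pT : forall z, D L S z -> p (z, t) @[t --> T^'-] --> 0)
           (qT : forall z, D L S z -> q (z, t) @[t --> 0^'+] --> 0).

Local Notation e := (margin T).

Lemma inner_box_sub k :
  (box L S (e k) (T - e k) : set (R * R * R)) `<=` P_T L S T.
Proof. by apply: box_sub_P_T; rewrite ?gtrBl margin_gt0. Qed.

Lemma P_T_margin z k : D L S z -> P_T L S T (z, T - e k) /\ P_T L S T (z, e k).
Proof.
move=> Dz; have := margin_gt0 T0 k; have := margin_lt T0 k => ? ?.
by split; apply: (@inner_box_sub k); split => //=; rewrite in_itv/= lexx ltW.
Qed.

(** At each end of the time interval one factor tends to zero and the other stays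
bounded; which one it is differs between the two ends. *)
Lemma boundary_cvg0 z : D L S z ->
  p (z, T - e k) * q (z, T - e k) - p (z, e k) * q (z, e k) @[k --> \oo] --> 0.
Proof.
move=> Dz; rewrite -[X in _ --> X](subr0 0).
have pk : p (z, T - e k) @[k --> \oo] --> 0.
  apply: ((cvg_at_leftP (fun t => p (z, t)) T 0).1 (pT Dz)); split.
    by move=> k; rewrite gtrBl margin_gt0.
  rewrite -[X in _ --> X]subr0.
  by apply: cvgB; [exact: cvg_cst|exact: cvg_margin].
have qk : q (z, e k) @[k --> \oo] --> 0.
  apply: ((cvg_at_rightP (fun t => q (z, t)) 0 0).1 (qT Dz)); split.
    by move=> k; rewrite margin_gt0.
  exact: cvg_margin.
apply: cvgB.
- apply/norm_cvg0P; apply: (@squeeze_cvgr _ _ _ _ (cst 0)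
    (fun k => `|p (z, T - e k)| * N)).
  + near=> k; rewrite normr_ge0 normrM ler_wpM2l//.
    by apply: qN; exact: (P_T_margin k Dz).1.
  + exact: cvg_cst.
  + rewrite -[X in _ --> X](mul0r N).
    by apply: cvgM; [exact/norm_cvg0P|exact: cvg_cst].
- apply/norm_cvg0P; apply: (@squeeze_cvgr _ _ _ _ (cst 0)
    (fun k => M * `|q (z, e k)|)).
  + near=> k; rewrite normr_ge0 normrM ler_wpM2r//.
    by apply: pM; exact: (P_T_margin k Dz).2.
  + exact: cvg_cst.
  + rewrite -[X in _ --> X](mulr0 M).
    by apply: cvgM; [exact: cvg_cst|exact/norm_cvg0P].
Unshelve. all: by end_near. Qed.

(** Pointwise convergence of the boundary terms is enough: p and q being bounded,
dominated convergence on the rectangle D applies. *)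
Lemma green_limit :
  (\int[(mu \x mu) \x mu]_(w in box L S (e k) (T - e k))
    (green_density p p_t p_xx p_yy q q_t q_xx q_yy w)%:E)%E
    @[k --> \oo] --> 0%E.
Proof.
have e0 k := margin_gt0 T0 k.
have eT k : T - e k < T by rewrite gtrBl.
under eq_fun do
  rewrite (green_formula L0 S0 Cp Cq p0 q0 (e0 _) (margin_lt T0 _) (eT _)).
have -> : 0%E = (\int[mu \x mu]_(z in D L S) (0 : R)%:E)%E.
  by rewrite integral0.
have mD := measurable_D L S.
have [| | | | |_ _ lim] := @dominated_convergence _ _ _ (@area R) (D L S) mD
  (fun k z => (p (z, T - e k) * q (z, T - e k) - p (z, e k) * q (z, e k))%:E)
  (cst 0%E) (cst (M * N + M * N)%:E); last exact: lim.
- move=> k; apply/measurable_EFinP.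
  exact (measurable_green_boundary Cp Cq (e0 k) (margin_lt T0 k) (eT k)).
- exact: measurable_cst.
- apply: aeW => z Dz; apply: cvg_EFin; first by near=> k.
  exact: boundary_cvg0.
- apply: measurable_bounded_integrable => //.
  + exact: measure_D_lty.
  + by exists `|M * N + M * N|; split=> // B MB z _ /=; exact: ltW.
- apply: aeW => z k Dz; rewrite lee_fin; have [PT P0] := P_T_margin k Dz.
  by apply: le_trans (ler_normB _ _) _; rewrite !normrM lerD ?ler_pM// (pM, qN).
Unshelve. all: by end_near. Qed.
End green_limit.

(** * The gradient inequality for convex functions *)

Lemma dot_gradient (R : realType) n (f : 'cV[R]_n -> R) (a v : 'cV[R]_n) :
  differentiable f a -> dot (gradient f a) v = 'D_v f a.
Proof.
move=> df; rewrite deriveE// /dot [v in RHS]matrix_sum_delta linear_sum.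
apply: eq_bigr => i _; rewrite big_ord1 linearZ mxE deriveE//.
by rewrite mulrC.
Qed.

(** For 0 < h <= 1 the difference quotient of f at a in the direction b - a is at
most f b - f a, because a + h (b - a) is the convex combination of b and a with
weight h; let h tend to 0 from the right. *)
Lemma convex_function_gradient (R : realType) n (f : 'cV[R]_n -> R)
    (a b : 'cV[R]_n) :
  convex_function [set: 'cV[R]_n] f -> differentiable f a ->
  dot (gradient f a) (b - a) <= f b - f a.
Proof.
move=> cvxf df; rewrite dot_gradient//.
have /cvg_dnbhs_at_right : h^-1 *: ((f \o shift a) (h *: (b - a)) - f a)
    @[h --> 0^'] --> 'D_(b - a) f a by exact: diff_derivable.
move=> cv; apply: (cvgr_to_le cv); near=> h.
have h0 : 0 < h by near: h; exact: nbhs_right_gt.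
have h1 : h <= 1 by near: h; exact: nbhs_right_le.
rewrite /= [_ *: _]mulrC ler_pdivrMr//.
have := cvxf (Itv01 (ltW h0) h1) b a (mem_set I) (mem_set I).
rewrite convRE /conv/= => cvx.
rewrite lerBlDr; apply: le_trans (le_trans cvx _).
  by rewrite scalerBr scalerBl scale1r addrA addrAC.
by rewrite /unstable.onem; lra.
Unshelve. all: by end_near. Qed.

(** * Comparing integrals up to a vanishing defect *)

Section comparison.
Context d (X : measurableType d) (R : realType).
Variables (m : {measure set X -> \bar R}) (P : set X) (Q : (set X)^nat).
Hypotheses (ndQ : nondecreasing_seq Q) (mQ : forall k, measurable (Q k)).
Hypothesis QP : \bigcup_k Q k = P.
Variables (f1 f2 F : X -> R).
Hypotheses (mf1 : measurable_fun P f1) (mf2 : measurable_fun P f2).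
Hypothesis iF : forall k, m.-integrable (Q k) (EFin \o F).
Hypothesis F0 : (\int[m]_(x in Q k) (F x)%:E)%E @[k --> \oo] --> 0%E.
Hypothesis Ff : forall x, P x -> F x <= f1 x - f2 x.
Local Open Scope ereal_scope.

Let mP : measurable P.
Proof. by rewrite -QP; exact: bigcup_measurable. Qed.

Let QsubP k : Q k `<=` P.
Proof. by rewrite -QP; exact: bigcup_sup. Qed.

(* f1 - f2 = M - N with M and N nonnegative *)
Let M x := ((f1^\+)%R x + (f2^\-)%R x)%R.
Let N x := ((f1^\-)%R x + (f2^\+)%R x)%R.

Let mM : measurable_fun P M.
Proof.
by apply: measurable_funD; [exact: measurable_funrpos|exact: measurable_funrneg].
Qed.

Let mN : measurable_fun P N.
Proof.
by apply: measurable_funD; [exact: measurable_funrneg|exact: measurable_funrpos].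
Qed.

Let M0 x : (0 <= M x)%R. Proof. by rewrite addr_ge0. Qed.
Let N0 x : (0 <= N x)%R. Proof. by rewrite addr_ge0. Qed.

Let NFM x : P x -> (N x + F x <= M x)%R.
Proof.
have fE (f : X -> R) y : f y = ((f^\+)%R y - (f^\-)%R y)%R :> R.
  by rewrite -[in LHS](funrposBneg f).
move=> /Ff; rewrite (fE f1) (fE f2) /M /N; lra.
Qed.

(* On each Q k the inequality N + F <= M integrates term by term, N being
   integrable there since 0 <= N <= M - F. The bound by the integral of M over P
   does not depend on k, and monotone convergence passes N to the limit. *)
Let posneg_le : \int[m]_(x in P) (M x)%:E < +oo ->
  \int[m]_(x in P) (N x)%:E <= \int[m]_(x in P) (M x)%:E.
Proof.
move=> Moo.
have iM : m.-integrable P (EFin \o M).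
  apply/integrableP; split; first exact/measurable_EFinP.
  by under eq_integral do rewrite /= ger0_norm//.
have iMQ k : m.-integrable (Q k) (EFin \o M) by exact: integrableS iM.
have iNQ k : m.-integrable (Q k) (EFin \o N).
  apply: (le_integrable (mQ k) _ _ (integrableB (mQ k) (iMQ k) (iF k))).
    by apply/measurable_EFinP; exact: measurable_funS mN.
  move=> x /QsubP /NFM NFMx; rewrite /= lee_fin ger0_norm//.
  by rewrite -lerBrDr in NFMx; rewrite (le_trans NFMx)// ler_norm.
apply: (@cvge_le _ \oo _ _ (fun k => \int[m]_(x in Q k) (N x)%:E
    + \int[m]_(x in Q k) (F x)%:E)).
  near=> k; rewrite -integralD//.
  apply: (@le_trans _ _ (\int[m]_(x in Q k) (M x)%:E)).
    apply: le_integral => //; first exact: integrableD.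
    by move=> x; rewrite inE => /QsubP /NFM; rewrite lee_fin.
  apply: ge0_subset_integral => //; first exact/measurable_EFinP.
  by move=> x _; rewrite lee_fin.
rewrite -[\int[m]_(x in P) (N x)%:E]adde0; apply: cvgeD => //.
  by rewrite fin_num_adde_defl.
rewrite -QP; apply: ge0_nondecreasing_set_cvg_integral => //.
  by move=> k; apply/measurable_EFinP; exact: measurable_funS mN.
by move=> k x _; rewrite lee_fin.
Unshelve. all: by end_near. Qed.

(** Formally, f2 + F <= f1 and F has integral 0. F need not be integrable on P,
however, and the integrals of f1 and f2 may be infinite. If that of f1 is +oo or
that of f2 is -oo the conclusion is clear; otherwise M = f1^+ + f2^- has a finite
integral, which dominates that of N = f1^- + f2^+. *)
Lemma integral_le_of_vanishing_defect :
  \int[m]_(x in P) ((f1^\+)%R x)%:E < +oo \/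
    \int[m]_(x in P) ((f1^\-)%R x)%:E < +oo ->
  \int[m]_(x in P) ((f2^\+)%R x)%:E < +oo \/
    \int[m]_(x in P) ((f2^\-)%R x)%:E < +oo ->
  \int[m]_(x in P) (f2 x)%:E <= \int[m]_(x in P) (f1 x)%:E.
Proof.
move=> d1 d2; rewrite integralE [leRHS]integralE.
have eP f : \int[m]_(x in P) ((fun x => (f x)%:E)^\+ x)
          = \int[m]_(x in P) ((f^\+)%R x)%:E.
  by rewrite [X in integral _ _ X](funerpos f).
have eN f : \int[m]_(x in P) ((fun x => (f x)%:E)^\- x)
          = \int[m]_(x in P) ((f^\-)%R x)%:E.
  by rewrite [X in integral _ _ X](funerneg f).
rewrite !eP !eN.
have iD (f g : X -> R) : measurable_fun P f -> measurable_fun P g ->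
    (forall x, 0 <= f x)%R -> (forall x, 0 <= g x)%R ->
    \int[m]_(x in P) (f x + g x)%R%:E =
    \int[m]_(x in P) (f x)%:E + \int[m]_(x in P) (g x)%:E.
  move=> mf mg f0 g0; under eq_integral do rewrite EFinD.
  rewrite ge0_integralD//;
    by [apply/measurable_EFinP | move=> x _; rewrite lee_fin].
have mp (f : X -> R) : measurable_fun P f -> measurable_fun P (f^\+)%R.
  exact: measurable_funrpos.
have mn (f : X -> R) : measurable_fun P f -> measurable_fun P (f^\-)%R.
  exact: measurable_funrneg.
have := posneg_le; rewrite /M /N.
rewrite (iD _ _ (mp _ mf1) (mn _ mf2))// (iD _ _ (mn _ mf1) (mp _ mf2))//.
have a1 : 0 <= \int[m]_(x in P) ((f1^\+)%R x)%:E.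
  by apply: integral_ge0 => x _; rewrite lee_fin.
have b1 : 0 <= \int[m]_(x in P) ((f1^\-)%R x)%:E.
  by apply: integral_ge0 => x _; rewrite lee_fin.
have a2 : 0 <= \int[m]_(x in P) ((f2^\+)%R x)%:E.
  by apply: integral_ge0 => x _; rewrite lee_fin.
have b2 : 0 <= \int[m]_(x in P) ((f2^\-)%R x)%:E.
  by apply: integral_ge0 => x _; rewrite lee_fin.
move: d1 d2 a1 b1 a2 b2.
move: (\int[m]_(x in P) ((f1^\+)%R x)%:E) (\int[m]_(x in P) ((f1^\-)%R x)%:E).
move: (\int[m]_(x in P) ((f2^\+)%R x)%:E) (\int[m]_(x in P) ((f2^\-)%R x)%:E).
move=> [a2| |] [b2| |] [a1| |] [b1| |] //=; try by case.
- by move=> _ _ _ _ _ _ /(_ (ltry _)); rewrite -!EFinD !lee_fin; lra.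
- by move=> _ _ _ _ _ _ /(_ (ltry _)).
- by move=> *; exact: leey.
- by move=> *; exact: leNye.
- by move=> _ _ _ _ _ _ /(_ (ltry _)).
- by move=> _ _ _ _ _ _ /(_ (ltry _)).
- by move=> _ [].
Qed.
End comparison.

(** * Coordinates of classical solutions *)

Lemma continuous_slice_t (R : realType) (z : R * R) :
  continuous (fun t : R => (z, t)).
Proof. by move=> t; exact: (cvg_pair (cvg_cst z) cvg_id). Qed.

Lemma continuous_slice_x (R : realType) (y t : R) :
  continuous (fun x : R => (x, y, t)).
Proof.
by move=> x; exact: (cvg_pair (cvg_pair cvg_id (cvg_cst y)) (cvg_cst t)).
Qed.

Lemma continuous_slice_y (R : realType) (x t : R) :
  continuous (fun y : R => (x, y, t)).
Proof.
by move=> y; exact: (cvg_pair (cvg_pair (cvg_cst x) cvg_id) (cvg_cst t)).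
Qed.

Lemma C21_coord (R : realType) (L S T : R) n (u : R * R * R -> 'cV[R]_n) i :
  C21 L S T u ->
  scalar_C21 L S T (fun p => u p i 0) (fun p => d_t u p i 0)
    (fun p => d_x L (d_x L u) p i 0) (fun p => d_y S (d_y S u) p i 0).
Proof.
move=> [du [cu [cx cy] ct cxx cyy]].
have cc (v : R * R * R -> 'cV[R]_n) : {within P_T L S T, continuous v} ->
    {within P_T L S T, continuous (fun p => v p i 0)}.
  exact: within_continuous_coord.
have inP x y t : 0 <= x <= L -> 0 <= y <= S -> 0 < t < T -> P_T L S T (x, y, t).
  by move=> xL yS tT; split; [split|]; rewrite /= in_itv.
split; try exact: cc.
- move=> z a b Dz a0 bT; have inT t : `[a, b]%classic t -> P_T L S T (z, t).
    rewrite /= in_itv/= => /andP[ta tb]; split => //=.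
    by rewrite in_itv/= (lt_le_trans a0)// (le_lt_trans tb).
  have ch := @continuous_slice_t R z.
  split.
  + exact: within_continuous_precomp ch inT (cc _ cu).
  + exact: within_continuous_precomp ch inT (cc _ ct).
  + move=> t /andP[ta tb]; have /inT/du[_ _ dt _ _] : `[a, b]%classic t.
      by rewrite /= in_itv/= !ltW.
    exact: (@is_derive_d_t _ _ u (z, t)).
- move=> y t yS tT; have inX x : `[0, L]%classic x -> P_T L S T (x, y, t).
    by rewrite /= in_itv/= => xL; exact: inP.
  have ch := @continuous_slice_x R y t.
  exists (fun x => d_x L u (x, y, t) i 0); split; split.
  + exact: within_continuous_precomp ch inX (cc _ cu).
  + exact: within_continuous_precomp ch inX (cc _ cx).
  + move=> x xL; have /inX/du[dx _ _ _ _] : `[0, L]%classic x.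
      by case/andP: xL => ? ?; rewrite /= in_itv/= !ltW.
    exact: (derivable_in_is_derive i xL dx).
  + exact: within_continuous_precomp ch inX (cc _ cx).
  + exact: within_continuous_precomp ch inX (cc _ cxx).
  + move=> x xL; have /inX/du[_ _ _ dx _] : `[0, L]%classic x.
      by case/andP: xL => ? ?; rewrite /= in_itv/= !ltW.
    exact: (derivable_in_is_derive i xL dx).
- move=> x t xL tT; have inY y : `[0, S]%classic y -> P_T L S T (x, y, t).
    by rewrite /= in_itv/= => yS; exact: inP.
  have ch := @continuous_slice_y R x t.
  exists (fun y => d_y S u (x, y, t) i 0); split; split.
  + exact: within_continuous_precomp ch inY (cc _ cu).
  + exact: within_continuous_precomp ch inY (cc _ cy).
  + move=> y yS; have /inY/du[_ dy _ _ _] : `[0, S]%classic y.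
      by case/andP: yS => ? ?; rewrite /= in_itv/= !ltW.
    exact: (derivable_in_is_derive i yS dy).
  + exact: within_continuous_precomp ch inY (cc _ cy).
  + exact: within_continuous_precomp ch inY (cc _ cyy).
  + move=> y yS; have /inY/du[_ _ _ _ dy] : `[0, S]%classic y.
      by case/andP: yS => ? ?; rewrite /= in_itv/= !ltW.
    exact: (derivable_in_is_derive i yS dy).
Qed.

(** Nothing is known about u on the vertical line through z outside ]0, T[ and t0,
hence the restricted filter. *)
Lemma classical_class_face_cvg (R : realType) (L S T t0 : R) n
    (u : R * R * R -> 'cV[R]_n) z i :
  classical_class L S T t0 u -> D L S z ->
  u (z, t) i 0 @[t --> within (`]0, T[ `|` [set t0]) (nbhs t0)]
    --> u (z, t0) i 0.
Proof.
move=> [_ cu _] Dz.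
have := @within_continuous_precomp R _ _ (`]0, T[ `|` [set t0]) _
  (fun t => (z, t)) _ _ _ (within_continuous_coord (i := i) cu).
move=> /(_ _ _)/subspace_continuousP; apply; last by right.
- exact: continuous_slice_t.
- move=> t [tT|->]; first by left; left; split.
  by right; apply: subset_closure.
Qed.

Lemma classical_class_coord_bounded (R : realType) (L S T t0 : R) n
    (u : R * R * R -> 'cV[R]_n) i :
  classical_class L S T t0 u ->
  exists M, forall p, P_T L S T p -> `|u p i 0| <= M.
Proof.
move=> [_ _ bu]; have [M [Mreal uM]] := bu; exists (`|M| + 1) => p Pp.
apply: le_trans (uM (`|M| + 1) _ p Pp); last first.
  by rewrite (le_lt_trans (ler_norm _))// ltrDl.
rewrite /Num.norm/= mx_normrE.
exact: (@le_bigmax _ _ _ 0 (fun ij => `|u p ij.1 ij.2|) (i, 0)).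
Qed.

Section dot_algebra.
Variables (R : realType) (n : nat).
Implicit Types a b c : 'cV[R]_n.

Lemma dotDl a b c : dot (a + b) c = dot a c + dot b c.
Proof. by rewrite -big_split; apply: eq_bigr => i _; rewrite mxE mulrDl. Qed.

Lemma dotC a b : dot a b = dot b a.
Proof. by apply: eq_bigr => i _; rewrite mulrC. Qed.

Lemma dotNl a b : dot (- a) b = - dot a b.
Proof. by rewrite /dot -sumrN; apply: eq_bigr => i _; rewrite mxE mulNr. Qed.

Lemma dotBl a b c : dot (a - b) c = dot a c - dot b c.
Proof. by rewrite dotDl dotNl. Qed.

Lemma dotBr a b c : dot a (b - c) = dot a b - dot a c.
Proof. by rewrite dotC dotBl !(dotC _ a). Qed.

Lemma dotDr a b c : dot a (b + c) = dot a b + dot a c.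
Proof. by rewrite dotC dotDl !(dotC _ a). Qed.

Lemma dotE a b : dot a b = (a^T *m b) 0 0.
Proof. by rewrite mxE; apply: eq_bigr => i _; rewrite mxE. Qed.

Lemma dot_trmx (A : 'M[R]_n) a b : dot (A^T *m a) b = dot a (A *m b).
Proof. by rewrite !dotE trmx_mul trmxK mulmxA. Qed.

End dot_algebra.

Lemma cvg_sum0 (R : realType) n (a : 'I_n -> nat -> \bar R) :
  (forall i, a i k @[k --> \oo] --> 0%E) ->
  (\sum_(i < n) a i k)%E @[k --> \oo] --> 0%E.
Proof.
elim: n a => [|n IH] a a0.
  by under eq_fun do rewrite big_ord0; exact: cvg_cst.
under eq_fun do rewrite big_ord_recl.
have := @cvgeD _ _ _ _ _ _ _ _ _ (a0 ord0) (IH _ (fun i => a0 (lift ord0 i))).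
by rewrite adde0; apply.
Qed.

(** * Optimality *)

Lemma box_margin_nondecreasing (R : realType) (L S T : R) : 0 < T ->
  nondecreasing_seq (fun k => box L S (margin T k) (T - margin T k)).
Proof.
move=> T0 i j ij; rewrite subsetEset => p [Dp /=].
rewrite in_itv/= => /andP[ip pi].
split => //=; rewrite in_itv/= (le_trans _ ip) ?margin_nincr//=.
by rewrite (le_trans pi)// lerB// margin_nincr.
Qed.

Lemma bigcup_box_margin (R : realType) (L S T : R) : 0 < T ->
  \bigcup_k box L S (margin T k) (T - margin T k) = P_T L S T.
Proof.
move=> T0; apply/seteqP; split=> [p [k _]|p [Dp /=]].
  by apply: box_sub_P_T; rewrite ?gtrBl margin_gt0.
rewrite in_itv/= => /andP[p0 pT].
have m0 : 0 < Num.min p.2 (T - p.2) by rewrite lt_min p0 subr_gt0.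
have [k _ /(_ k (leqnn k))] := ((cvgrPdist_lt _ _).1 (cvg_margin T)) _ m0.
rewrite sub0r normrN gtr0_norm ?margin_gt0// lt_min => /andP[kp kT].
exists k => //; split => //=; rewrite in_itv/= (ltW kp)/=.
by rewrite lerBrDr addrC -lerBrDr ltW.
Qed.

Section optimality.
Variables (R : realType) (L S T : R) (n r : nat)
    (A : 'M[R]_n) (B : 'M[R]_(n, r)) (U : set 'cV[R]_r)
    (g : 'cV[R]_n -> R * R * R -> R)
    (alpha beta_0 beta_S gamma_0 gamma_L : R * R -> 'cV[R]_n).
Variables (wt w : R * R * R -> 'cV[R]_r) (ut u us : R * R * R -> 'cV[R]_n).
Hypotheses (L0 : 0 < L) (S0 : 0 < S) (T0 : 0 < T).
Hypothesis gC : forall p, (D L S `*` `[0, T]) p ->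
     convex_function [set: 'cV[R]_n] (fun v => g v p) /\
     continuously_differentiable (fun v => g v p).
Hypotheses (Uw : admissible_control L S T U w)
  (solt : solution L S T A B alpha beta_0 beta_S gamma_0 gamma_L wt ut)
  (sol : solution L S T A B alpha beta_0 beta_S gamma_0 gamma_L w u)
  (adj : adjoint_solution L S T A g ut us)
  (maxc : maximum_condition L S T B U wt us).

Local Notation mu := (@lebesgue_measure R).

Let density i := green_density (fun p => us p i 0) (fun p => d_t us p i 0)
  (fun p => d_x L (d_x L us) p i 0) (fun p => d_y S (d_y S us) p i 0)
  (fun p => u p i 0 - ut p i 0) (fun p => d_t u p i 0 - d_t ut p i 0)
  (fun p => d_x L (d_x L u) p i 0 - d_x L (d_x L ut) p i 0)
  (fun p => d_y S (d_y S u) p i 0 - d_y S (d_y S ut) p i 0).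

(** The sum of the densities is d/dt <us, z> + <Lap us, z> - <us, Lap z>. After
substitution of the two state equations and of the adjoint equation, the
terms in A cancel by transposition and what remains is
<g'(ut), z> + <us, B w> - <us, B wt>. *)
Lemma cost_gap p : P_T L S T p ->
  \sum_(i < n) density i p <= g (u p) p - g (ut p) p.
Proof.
move=> Pp; have Qp : (D L S `*` `[0, T]) p.
  by case: Pp => Dp p2; split => //; exact: subset_itv_oo_cc p2.
have [cvxg [dg _]] := gC Qp.
have [_ /(_ p Pp) eqt _ _] := solt; have [_ /(_ p Pp) eq _ _] := sol.
have [_ /(_ p Pp) eqs _ _] := adj.
apply: le_trans (convex_function_gradient (u p) cvxg (dg (ut p))).
pose z := u p - ut p; pose grad := gradient (fun v => g v p) (ut p).
pose z_t := d_t u p - d_t ut p.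
pose lz := laplacian L S u p - laplacian L S ut p.
have -> : \sum_(i < n) density i p = dot (d_t us p + laplacian L S us p) z
    + dot (us p) (z_t - lz).
  rewrite /dot -big_split; apply: eq_bigr => i _.
  rewrite /density /green_density /z /z_t /lz /laplacian /=.
  (* the derivatives, which are limits, become opaque before simplification *)
  move: (us p) (d_t us p) (d_x L (d_x L us) p) (d_y S (d_y S us) p).
  move=> s s1 s2 s3.
  move: (u p) (d_t u p) (d_x L (d_x L u) p) (d_y S (d_y S u) p).
  move=> v v1 v2 v3.
  move: (ut p) (d_t ut p) (d_x L (d_x L ut) p) (d_y S (d_y S ut) p).
  move=> a a1 a2 a3.
  by rewrite !mxE; ring.
have -> : z_t - lz = A *m z + (B *m w p - B *m wt p).
  have -> : z_t - lz =
      (d_t u p - laplacian L S u p) - (d_t ut p - laplacian L S ut p).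
    rewrite /z_t /lz !opprB addrACA [RHS]addrACA; congr (_ + _); exact: addrC.
  by rewrite eq eqt mulmxBr opprD addrACA.
have -> : d_t us p + laplacian L S us p = grad - A^T *m us p.
  by rewrite -[LHS]opprK opprD eqs opprB.
rewrite dotBl dot_trmx (dotDr (us p) (A *m z)) addrA subrK gerDl dotBr.
have [_ ub] := maxc Pp; rewrite subr_le0 !(dotC (us p)).
by apply: ub; exists (w p) => //; exact: Uw.
Qed.

(** The adjoint state vanishes on the face t = T, the difference of the two states
on the face t = 0, where both equal alpha, and both vanish laterally. *)
Lemma density_limit i :
  (\int[(mu \x mu) \x mu]_(p in box L S (margin T k) (T - margin T k))
    (density i p)%:E)%E @[k --> \oo] --> 0%E.
Proof.
have [ct _ ft lt] := solt; have [c _ f l] := sol; have [cs _ fs ls] := adj.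
have [C21t _ _] := ct; have [C21u _ _] := c; have [C21s _ _] := cs.
have [Mt utM] := classical_class_coord_bounded i ct.
have [M uM] := classical_class_coord_bounded i c.
have [Ms usM] := classical_class_coord_bounded i cs.
apply: (@green_limit _ L S T L0 S0 T0 _ _ _ _ _ _ _ _ (C21_coord i C21s)
  (scalar_C21B (C21_coord i C21u) (C21_coord i C21t)) _ _ Ms (M + Mt) usM).
- move=> t tT; have [lx ly] := ls t tT.
  by split=> [x /lx[-> ->]|y /ly[-> ->]]; rewrite mxE.
- move=> t tT; have [lx ly] := l t tT; have [ltx lty] := lt t tT.
  split=> [x xL|y yS] /=.
    by have [-> ->] := lx x xL; have [-> ->] := ltx x xL; rewrite !subrr.
  by have [-> ->] := ly y yS; have [-> ->] := lty y yS; rewrite !subrr.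
- move=> p Pp; apply: le_trans (ler_normB _ _) _.
  by rewrite lerD ?uM ?utM.
- move=> z Dz; have := classical_class_face_cvg (i := i) cs Dz.
  have -> : us (z, T) = 0 by case: z Dz => x y; exact: fs.
  rewrite mxE; apply: cvg_trans; apply: cvg_app => V VT.
  have Tt : \forall t \near T, 0 < t by exact: lt_nbhsr.
  suff H : \forall t \near T, t < T -> V t by exact: H.
  have {}VT : \forall t \near T, (`]0, T[ `|` [set T])%classic t -> V t.
    by exact: VT.
  apply: filterS2 VT Tt => t Vt t0 tT; apply: Vt; left.
  by rewrite /= in_itv/= t0.
- move=> z Dz; have := classical_class_face_cvg (i := i) c Dz.
  have := classical_class_face_cvg (i := i) ct Dz.
  have -> : u (z, 0) = alpha z by case: z Dz => x y; exact: f.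
  have -> : ut (z, 0) = alpha z by case: z Dz => x y; exact: ft.
  move=> cvt cvu; have := cvgB cvu cvt; rewrite subrr => cvz V /cvz Vz.
  have Tt : \forall t \near (0 : R), t < T by exact: lt_nbhsl.
  have {}Vz : \forall t \near (0 : R), (`]0, T[ `|` [set (0 : R)])%classic t ->
      V (u (z, t) i 0 - ut (z, t) i 0) by exact: Vz.
  suff H : \forall t \near (0 : R), 0 < t -> V (u (z, t) i 0 - ut (z, t) i 0).
    exact: H.
  apply: filterS2 Vz Tt => t Vt tT t0; apply: Vt; left.
  by rewrite /= in_itv/= t0.
Qed.

Lemma cost_le : J_defined L S T g ut -> J_defined L S T g u ->
  (J L S T g ut <= J L S T g u)%E.
Proof.
move=> [mt dt] [mesu du].
have [ct _ _ _] := solt; have [c _ _ _] := sol; have [cs _ _ _] := adj.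
have [C21t _ _] := ct; have [C21u _ _] := c; have [C21s _ _] := cs.
have idens i k : ((mu \x mu) \x mu)%E.-integrable
    (box L S (margin T k) (T - margin T k)) (EFin \o density i).
  apply: (green_density_integrable (C21_coord i C21s)
    (scalar_C21B (C21_coord i C21u) (C21_coord i C21t))).
  - exact: margin_gt0.
  - by rewrite gtrBl margin_gt0.
have mQ k := measurable_box L S (margin T k) (T - margin T k).
rewrite /J; apply: (@integral_le_of_vanishing_defect _ _ _
  ((mu \x mu) \x mu)%E (P_T L S T) _
  (box_margin_nondecreasing L S T0) mQ (bigcup_box_margin L S T0)
  (fun p => g (u p) p) (fun p => g (ut p) p) (fun p => \sum_(i < n) density i p)
  mesu mt _ _ cost_gap).
- move=> k; have : ((mu \x mu) \x mu)%E.-integrable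
      (box L S (margin T k) (T - margin T k))
      (fun p => \sum_(i < n) (density i p)%:E)%E.
    by apply: integrable_sum => // i _; exact: idens.
  by apply: eq_integrable => // p _; rewrite /= sumEFin.
- have := cvg_sum0 density_limit.
  apply: cvg_trans; apply: near_eq_cvg; near=> k.
  rewrite -integral_sum//; last by move=> i; exact: idens.
  by apply: eq_integral => p _; rewrite sumEFin.
Unshelve. all: by end_near. Qed.
End optimality.
Theorem theorem5p2 (R : realType) (L S T : R) (n r : nat)
    (A : 'M[R]_n) (B : 'M[R]_(n, r)) (U : set 'cV[R]_r)
    (g : 'cV[R]_n -> R * R * R -> R)
    (alpha beta_0 beta_S gamma_0 gamma_L : R * R -> 'cV[R]_n)
    (wt : R * R * R -> 'cV[R]_r) (ut us : R * R * R -> 'cV[R]_n) :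
  0 < L -> 0 < S -> 0 < T ->
  convex_set U -> closed U ->
  (forall p, (D L S `*` `[0, T]) p ->
     convex_function [set: 'cV[R]_n] (fun v => g v p) /\
     continuously_differentiable (fun v => g v p)) ->
  {within D L S, continuous alpha} ->
  {within `[0, L] `*` `[0, T], continuous beta_0} ->
  {within `[0, L] `*` `[0, T], continuous beta_S} ->
  {within `[0, S] `*` `[0, T], continuous gamma_0} ->
  {within `[0, S] `*` `[0, T], continuous gamma_L} ->
  admissible_control L S T U wt ->
  solution L S T A B alpha beta_0 beta_S gamma_0 gamma_L wt ut ->
  J_defined L S T g ut ->
  adjoint_solution L S T A g ut us ->
  maximum_condition L S T B U wt us ->
  minimizes_J L S T A B U g alpha beta_0 beta_S gamma_0 gamma_L ut.
Proof.
move=> L0 S0 T0 _ _ gC _ _ _ _ _ Uwt solt Jt adj maxc.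
split; first by split => //; exists wt.
move=> u [[w [Uw sol]] Ju].
exact: cost_le L0 S0 T0 gC Uw solt sol adj maxc Jt Ju.
Qed.
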